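(* Let $H$ be a graph of order $k$ with at least one edge, and let $\widetilde{\sigma}(H)$ be the maximum of $\widetilde{\sigma}_i(H)$ over $i\in\{\alpha(H)+1,\ldots,k\}$. Then, as $n\to\infty$ (with $H$ fixed), $$\sigma(H,n)=\widetilde{\sigma}(H)\,n+o(n).$$
   Context: All graphs are finite and simple; the order of a graph is its number of vertices, $\alpha(H)$ is the independence number of $H$, and $\Delta(F)$ is the maximum degree of $F$. A sequence of nonnegative integers $\pi=(d_1,\dots,d_n)$ is graphic if it is the degree sequence of some simple graph of order $n$; such a graph is called a realization of $\pi$. $\sigma(\pi)$ denotes the sum of the terms of $\pi$. A graphic sequence $\pi$ is potentially $H$-graphic if at least one realization of $\pi$ contains $H$ as a (not necessarily induced) subgraph. $\sigma(H,n)$ denotes the minimum even integer such that every $n$-term graphic sequence $\pi$ with $\sigma(\pi)\ge\sigma(H,n)$ is potentially $H$-graphic. For $i\in\{\alpha(H)+1,\ldots,k\}$, where $k$ is the order of $H$, define $$\nabla_i(H)=\min\{\Delta(F): F \text{ is an induced subgraph of } H \text{ with } |V(F)|=i\},\qquad \widetilde{\sigma}_i(H)=2(k-i)+\nabla_i(H)-1.$$ *)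

(* Defs.v *)
From mathcomp Require Import all_boot boolp.

Set Implicit Arguments.
Unset Strict Implicit.
Unset Printing Implicit Defensive.

Record sgraph : Type := SGraph {
  vertex :> finType;
  adj : rel vertex;
  adj_sym : symmetric adj;
  adj_irrefl : irreflexive adj }.

Definition gorder (G : sgraph) : nat := #|vertex G|.

Definition degree (G : sgraph) (x : G) : nat := #|[set y : G | adj x y]|.

Definition max_degree (G : sgraph) : nat := \max_(x : G) degree x.

Definition independent (G : sgraph) (A : {set G}) : bool :=
  [forall x in A, forall y in A, ~~ adj x y].

Definition alpha (G : sgraph) : nat :=
  \max_(A : {set G} | independent A) #|A|.

Lemma induced_sym (G : sgraph) (A : {set G}) :
  symmetric (fun x y : {x : G | x \in A} => adj (val x) (val y)).
Proof. by move=> x y; apply: adj_sym. Qed.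

Lemma induced_irrefl (G : sgraph) (A : {set G}) :
  irreflexive (fun x y : {x : G | x \in A} => adj (val x) (val y)).
Proof. by move=> x; apply: adj_irrefl. Qed.

Definition induced (G : sgraph) (A : {set G}) : sgraph :=
  SGraph (@induced_sym G A) (@induced_irrefl G A).

(* Subgraph containment, up to isomorphism and not necessarily induced. *)
Definition contains (G H : sgraph) : Prop :=
  exists2 f : H -> G, injective f & forall x y : H, adj x y -> adj (f x) (f y).

(* Degree sequences are taken up to reordering; perm_eq also forces
   gorder G = size pi. *)
Definition realization (pi : seq nat) (G : sgraph) : Prop :=
  perm_eq [seq degree x | x : G] pi.

Definition graphic (pi : seq nat) : Prop := exists G : sgraph, realization pi G.

Definition potentially_graphic (H : sgraph) (pi : seq nat) : Prop :=
  exists2 G : sgraph, realization pi G & contains G H.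

Definition sigma_admissible (H : sgraph) (n s : nat) : Prop :=
  ~~ odd s /\
  forall pi : seq nat, size pi = n -> graphic pi -> s <= sumn pi ->
    potentially_graphic H pi.

Lemma sigma_admissible_ex (H : sgraph) (n : nat) :
  exists s, `[< sigma_admissible H n s >].
Proof.
exists (n * n).+1.*2; apply/asboolP; split; first by rewrite odd_double.
move=> pi szpi [G piG] le_pi; exfalso.
have cardG : #|vertex G| = n by rewrite -szpi -(perm_size piG) size_map -cardE.
have : sumn pi <= n * n.
  rewrite -(perm_sumn piG) sumnE big_map big_enum /= -{1}cardG -sum_nat_const.
  by apply: leq_sum => x _; rewrite -cardG; apply: max_card.
by rewrite leqNgt (leq_trans _ le_pi) // -addnn addSn ltnS leq_addr.
Qed.

(* Taking the minimum over nat instead of over all integers is harmless when H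
   has an edge: the zero sequence is then not potentially H-graphic, so an
   admissible value is positive. *)
Definition sigma (H : sgraph) (n : nat) : nat := ex_minn (sigma_admissible_ex H n).

(* The default gorder H of the iterated minimum is irrelevant when
   i <= gorder H: sets of size i then exist, and induced subgraphs of H have
   maximum degree at most gorder H. *)
Definition nabla (H : sgraph) (i : nat) : nat :=
  \big[minn/gorder H]_(A : {set H} | #|A| == i) max_degree (induced A).

(* No truncation occurs when alpha H < i <= gorder H: no vertex set of size i is
   independent, hence 0 < nabla H i. *)
Definition sigma_tilde_at (H : sgraph) (i : nat) : nat :=
  2 * (gorder H - i) + nabla H i - 1.

Definition sigma_tilde (H : sgraph) : nat :=
  \max_((alpha H).+1 <= i < (gorder H).+1) sigma_tilde_at H i.

(* Main.v *)
(* Write k = #|H|.  The proof gives sigma(H, n) = sigma_tilde(H) n + O(1).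

   Lower bound: for an index i attaining sigma_tilde, let l = k - i and
   d = nabla_i(H), and join K_l to disjoint copies of K_d.  In every realization
   of its degree sequence the l vertices of large degree are universal, and
   outside of them degrees are below l + d; a copy of H would have i vertices
   there, some of them with d neighbours among the i.

   Upper bound: fix a realization, and let L be the set of vertices whose degree
   is at least a constant depending on k.  Edges are switched, without changing
   the degree of any vertex, until H appears.
   - If #|L| >= k, switch k vertices of L into a clique; if that gets stuck, the
     neighbourhoods of two nonadjacent vertices contain a large complete
     bipartite graph X, Y.  Whenever X has k - alpha(H) elements and Y is large,
     nonedges inside Y can be traded for the missing edges inside X, which ends
     with a clique X joined to Y (or finds a k-clique in Y).
   - If #|L| < k, counting edges at L shows that many vertices v outside L have
     degree at least #|L| + nabla_(k - #|L|)(H) when #|L| < k - alpha(H), and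
     at least k - alpha(H) otherwise.  In the first case H is built on L and
     some of these v.  In the second, restrict to many v with the same trace A
     on L: either A has k - alpha(H) elements and is joined to all of them, or H
     is built on some B with A <= B <= L together with an independent set of
     these v.
   Since vertices outside L have bounded degree, "building" is possible one edge
   u v at a time: remove u x, v y and a far away edge p q, and add u v, x p,
   y q. *)
Require Import Defs.
From mathcomp Require Import all_boot zify boolp.

Set Implicit Arguments.
Unset Strict Implicit.
Unset Printing Implicit Defensive.

Ltac lia_nat :=
  repeat match goal with
  | H : ?P |- _ => lazymatch type of P with Prop => clear H end
  end;
  repeat match goal with
  | |- context [nat_of_bool ?b * nat_of_bool ?c] =>
      generalize (nat_of_bool b * nat_of_bool c); intro
  | |- context [nat_of_bool ?b] => generalize (nat_of_bool b); intro
  | |- context [card ?A] => generalize (card A); intro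
  end; lia.

(** * Degree-preserving edge switches *)

Section Switching.

Variable T : finType.
Implicit Types (e : rel T) (A : {set T}) (a b u v x y z : T).

Definition nbrs e x : {set T} := [set y | e x y].

Definition same_pair a b x y := (x == a) && (y == b) || (x == b) && (y == a).

Definition upd e a b c : rel T :=
  fun x y => if same_pair a b x y then c else e x y.

Lemma upd_sym e a b c : symmetric e -> symmetric (upd e a b c).
Proof.
move=> es x y; rewrite /upd /same_pair es orbC.
by rewrite [(y == a) && _]andbC [(y == b) && _]andbC.
Qed.

Lemma upd_irr e a b c : a != b -> irreflexive e -> irreflexive (upd e a b c).
Proof.
move=> ab ei x; rewrite /upd /same_pair ei; case: eqP => [->|_] /=.
  by rewrite (negPf ab).
by rewrite andbF.
Qed.

Lemma card_nbrs e A x : #|A :&: nbrs e x| = \sum_(y in A) e x y.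
Proof.
rewrite -sum1_card big_mkcond [RHS]big_mkcond; apply: eq_bigr => y _.
by rewrite !inE; case: (y \in A) (e x y) => [] [].
Qed.

(** The set [A] is arbitrary so that one identity serves both for full degrees ([A = setT]) and for
    neighbours in a region. *)
Lemma nbrs_add e A a b x : a != b -> symmetric e -> ~~ e a b ->
  #|A :&: nbrs (upd e a b true) x| =
  #|A :&: nbrs e x| + (x == a) * (b \in A) + (x == b) * (a \in A).
Proof.
move=> ab es eab.
have one c : \sum_(y in A) (y == c) = (c \in A).
  have [cA|cA] := boolP (c \in A).
    by rewrite (bigD1 c) //= eqxx big1 // => y /andP[_ /negPf ->].
  by rewrite big1 // => y yA; case: eqP => // yc; rewrite -yc yA in cA.
rewrite !card_nbrs -!one !big_distrr /= -!big_split /=; apply: eq_bigr => y _.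
rewrite /upd /same_pair.
case: (eqVneq x a) => [->|xa]; case: (eqVneq y b) => [->|yb] /=;
  rewrite ?(negPf ab) ?(negPf eab) //=.
- by rewrite mul0n !addn0.
- case: (eqVneq x b) => [->|xb] /=; last by rewrite !mul0n !addn0.
  by rewrite eq_sym (negPf ab) !addn0.
- case: (eqVneq x b) => [->|xb] /=; last by rewrite !mul0n !addn0.
  by case: (eqVneq y a) => [->|ya] /=; rewrite ?(es b a) ?(negPf eab) ?addn0.
Qed.

(** Adding the deleted pair back restores [e], so this is [nbrs_add] read backwards. *)
Lemma nbrs_del e A a b x : a != b -> symmetric e -> e a b ->
  #|A :&: nbrs (upd e a b false) x| + (x == a) * (b \in A)
    + (x == b) * (a \in A) = #|A :&: nbrs e x|.
Proof.
move=> ab es eab; rewrite -(@nbrs_add (upd e a b false)) //; first last.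
- by rewrite /upd /same_pair !eqxx.
- exact: upd_sym.
apply: eq_card => y; rewrite /nbrs !inE /upd; case: (boolP (same_pair a b x y)) => //.
by case/orP=> /andP[/eqP-> /eqP->]; rewrite ?[e b a]es eab.
Qed.

Lemma updN e a b c x y : ~~ same_pair a b x y -> upd e a b c x y = e x y.
Proof. by rewrite /upd => /negPf ->. Qed.

Lemma same_pairN a b x y : (a != x) || (b != y) -> (a != y) || (b != x) ->
  ~~ same_pair a b x y.
Proof.
rewrite /same_pair ![_ == a]eq_sym ![_ == b]eq_sym.
by case: (a == x) (b == y) (a == y) (b == x) => [] [] [] [].
Qed.

Ltac neq := first [assumption | rewrite eq_sym; assumption].

Ltac pair_neq :=
  apply: same_pairN; apply/orP; first [left; neq | right; neq].

Definition switching e e' :=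
  [/\ symmetric e', irreflexive e' & forall z, #|nbrs e' z| = #|nbrs e z|].

(** The four vertices carry an alternating 4-cycle, so each loses one neighbour and gains one. The
    inequalities not assumed follow by comparing edges with nonedges. *)
Lemma switch2 e a b x y : symmetric e -> irreflexive e ->
    a != b -> x != y -> e a x -> e b y -> ~~ e a b -> ~~ e x y ->
  exists2 e', switching e e' & forall z w,
    e' z w = same_pair a b z w || same_pair x y z w ||
      [&& e z w, ~~ same_pair a x z w & ~~ same_pair b y z w].
Proof.
move=> es ei ab xy eax eby neab nexy.
have ax : a != x by apply: contraTneq eax => <-; rewrite ei.
have by' : b != y by apply: contraTneq eby => <-; rewrite ei.
have ay : a != y by apply: contraTneq eby => <-; rewrite es.
have bx : b != x by apply: contraTneq eax => <-.
set e1 := upd e a x false; set e2 := upd e1 b y false; set e3 := upd e2 a b true.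
have s1 : symmetric e1 by exact: upd_sym.
have s2 : symmetric e2 by exact: upd_sym.
have s3 : symmetric e3 by exact: upd_sym.
exists (upd e3 x y true).
  split; [exact: upd_sym | by do 4!apply: upd_irr => // | move=> z].
  rewrite -[nbrs _ z]setTI -[nbrs e z]setTI.
  have e1by : e1 b y by rewrite /e1 updN //; pair_neq.
  have ne2ab : ~~ e2 a b by rewrite /e2 /e1 !updN //; pair_neq.
  have ne3xy : ~~ e3 x y by rewrite /e3 /e2 /e1 !updN //; pair_neq.
  have := nbrs_add setT z xy s3 ne3xy; have := nbrs_add setT z ab s2 ne2ab.
  have := nbrs_del setT z by' s1 e1by; have := nbrs_del setT z ax es eax.
  rewrite -/e1 -/e2 -/e3 !inE !muln1.
  by lia_nat.
move=> z w; rewrite /e3 /e2 /e1 /upd.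
by case: (same_pair a b z w) (same_pair x y z w) (same_pair a x z w)
  (same_pair b y z w) (e z w) => [] [] [] [] [].
Qed.

(* The closed walk u x p q y v alternates between edges and nonedges; x = y is
   allowed, which is what makes the switch available without any assumption on
   the neighbours x and y of u and v. *)
Lemma switch3 e (R : {set T}) u v x y p q : symmetric e -> irreflexive e ->
    u != v -> e u x -> e v y -> e p q ->
    ~~ e u v -> ~~ e x p -> ~~ e y q ->
    p \notin [:: x; u; y; v] -> q \notin [:: x; u; y; v] ->
    x \in R -> y \in R -> p \in R -> q \in R ->
  exists2 e', switching e e' &
    (forall z, #|R :&: nbrs e z| <= #|R :&: nbrs e' z|
       + ((z == u) && (v \notin R)) + ((z == v) && (u \notin R)))
    /\ forall z w, e' z w =
      [|| same_pair u v z w, same_pair x p z w, same_pair y q z w |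
      [&& e z w, ~~ same_pair u x z w, ~~ same_pair v y z w
          & ~~ same_pair p q z w]].
Proof.
move=> es ei uv eux evy epq neuv nexp neyq.
rewrite !inE !negb_or => /and4P[px pu py pv] /and4P[qx qu qy qv] xR yR pR qR.
have ux : u != x by apply: contraTneq eux => <-; rewrite ei.
have vy : v != y by apply: contraTneq evy => <-; rewrite ei.
have pq : p != q by apply: contraTneq epq => <-; rewrite ei.
have uy : u != y by apply: contraTneq evy => <-; rewrite es.
have vx : v != x by apply: contraTneq eux => <-.
set e1 := upd e u x false; set e2 := upd e1 v y false.
set e3 := upd e2 p q false; set e4 := upd e3 u v true; set e5 := upd e4 x p true.
have s1 : symmetric e1 by exact: upd_sym.
have s2 : symmetric e2 by exact: upd_sym.
have s3 : symmetric e3 by exact: upd_sym.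
have s4 : symmetric e4 by exact: upd_sym.
have s5 : symmetric e5 by exact: upd_sym.
have e1vy : e1 v y by rewrite /e1 updN //; pair_neq.
have e2pq : e2 p q by rewrite /e2 /e1 !updN //; pair_neq.
have ne3uv : ~~ e3 u v by rewrite /e3 /e2 /e1 !updN //; pair_neq.
have ne4xp : ~~ e4 x p by rewrite /e4 /e3 /e2 /e1 !updN //; pair_neq.
have ne5yq : ~~ e5 y q by rewrite /e5 /e4 /e3 /e2 /e1 !updN //; pair_neq.
have xp : x != p by rewrite eq_sym.
have yq : y != q by rewrite eq_sym.
(* For [A = setT] the two corrections agree, so degrees are kept. For [A = R] only [u] and [v] can
   lose, each when the other lies outside [R]. *)
have deltaE A z : #|A :&: nbrs (upd e5 y q true) z|
    + ((z == u) * (x \in A) + (z == x) * (u \in A)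
      + (z == v) * (y \in A) + (z == y) * (v \in A)
      + (z == p) * (q \in A) + (z == q) * (p \in A))
    = #|A :&: nbrs e z| + ((z == u) * (v \in A) + (z == v) * (u \in A)
      + (z == x) * (p \in A) + (z == p) * (x \in A)
      + (z == y) * (q \in A) + (z == q) * (y \in A)).
  have := nbrs_add A z yq s5 ne5yq; have := nbrs_add A z xp s4 ne4xp.
  have := nbrs_add A z uv s3 ne3uv; have := nbrs_del A z pq s2 e2pq.
  have := nbrs_del A z vy s1 e1vy; have := nbrs_del A z ux es eux.
  rewrite -/e1 -/e2 -/e3 -/e4 -/e5.
  by lia_nat.
exists (upd e5 y q true).
  split; [exact: upd_sym | by do 6!apply: upd_irr => // | move=> z].
  by have := deltaE setT z; rewrite !setTI !inE !muln1; lia_nat.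
split=> [z|z w].
  have := deltaE R z; rewrite xR yR pR qR.
  by case: (u \in R); case: (v \in R);
    rewrite /= !(muln1, muln0, andbT, andbF); lia_nat.
rewrite /e5 /e4 /e3 /e2 /e1 /upd.
by case: (same_pair u v z w) (same_pair x p z w) (same_pair y q z w)
  (same_pair u x z w) (same_pair v y z w) (same_pair p q z w) (e z w)
  => [] [] [] [] [] [] [].
Qed.

End Switching.

(** * Cliques, joins and many vertices of large degree *)

Lemma subset_with_card (T : finType) (A : {set T}) n : n <= #|A| ->
  exists2 B : {set T}, B \subset A & #|B| = n.
Proof.
move=> /card_geqP[s [us <- sA]]; exists [set x in s].
  by apply/subsetP => x; rewrite inE; apply: sA.
by rewrite cardsE; apply/card_uniqP.
Qed.

Section Realizable.

Variables (H : sgraph) (T : finType).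
Hypothesis h0 : H.
Implicit Types (e : rel T) (X Y I L : {set T}) (C : {set H}).

(** The vertex set stays [T], so every vertex, and not just the sequence, keeps its degree; this
    lets switches be chained. *)
Definition realizable e :=
  exists2 e', switching e e' &
    exists2 f : H -> T, injective f & forall a b, adj a b -> e' (f a) (f b).

Lemma realizable_switch e e' :
  switching e e' -> realizable e' -> realizable e.
Proof.
move=> [_ _ d1] [e2 [s2 i2 d2] fP]; exists e2 => //.
by split=> // z; rewrite d2 d1.
Qed.

Lemma realizable_hom e (f : H -> T) : symmetric e -> irreflexive e ->
  injective f -> (forall a b, adj a b -> e (f a) (f b)) -> realizable e.
Proof. by move=> es ei fi fP; exists e => //; exists f. Qed.

Lemma inj_split C X Y : [disjoint X & Y] -> #|~: C| <= #|X| -> #|C| <= #|Y| ->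
  exists f : H -> T, [/\ injective f, forall a, a \in C -> f a \in Y
    & forall a, a \notin C -> f a \in X].
Proof.
move=> dXY lX lY.
(* A default for [nth]: whichever of [C] and its complement contains [h0] has a nonempty target. *)
have [x0 _] : exists x0 : T, True.
  have [hC|hC] := boolP (h0 \in C).
    have /card_gt0P[x _] : 0 < #|Y|; last by exists x.
    by apply: leq_trans lY; apply/card_gt0P; exists h0.
  have /card_gt0P[x _] : 0 < #|X|; last by exists x.
  by apply: leq_trans lX; apply/card_gt0P; exists h0; rewrite inE.
pose g (D : {set H}) (Z : {set T}) a := nth x0 (enum Z) (index a (enum D)).
have gP (D : {set H}) (Z : {set T}) a : #|D| <= #|Z| -> a \in D -> g D Z a \in Z.
  move=> DZ aD; rewrite -mem_enum mem_nth // -cardE (leq_trans _ DZ) //.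
  by rewrite cardE index_mem mem_enum.
have gI (D : {set H}) (Z : {set T}) a b :
    #|D| <= #|Z| -> a \in D -> b \in D -> g D Z a = g D Z b -> a = b.
  move=> DZ aD bD /eqP; rewrite nth_uniq ?enum_uniq //; first last.
  - by rewrite -cardE (leq_trans _ DZ) // cardE index_mem mem_enum.
  - by rewrite -cardE (leq_trans _ DZ) // cardE index_mem mem_enum.
  by move=> /eqP /(congr1 (nth a (enum D))); rewrite !nth_index ?mem_enum.
pose f a := if a \in C then g C Y a else g (~: C) X a.
have fY a : a \in C -> f a \in Y by rewrite /f => aC; rewrite aC gP.
have fX a : a \notin C -> f a \in X.
  by rewrite /f => aC; rewrite (negPf aC) gP ?inE.
exists f; split=> // a b.
have [aC|aC] := boolP (a \in C); have [bC|bC] := boolP (b \in C).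
- by rewrite /f aC bC; apply: gI.
- by move=> fab; have := disjointFl dXY (fY _ aC); rewrite fab fX.
- by move=> fab; have := disjointFl dXY (fY _ bC); rewrite -fab fX.
- by rewrite /f (negPf aC) (negPf bC); apply: gI; rewrite ?inE.
Qed.

Lemma realizable_clique e X : symmetric e -> irreflexive e -> #|H| <= #|X| ->
  {in X &, forall x y, x != y -> e x y} -> realizable e.
Proof.
move=> es ei kX eX.
have [f [fi fX _]] : exists f : H -> T, [/\ injective f,
    forall a, a \in [set: H] -> f a \in X
    & forall a, a \notin [set: H] -> f a \in set0].
  by apply: inj_split; rewrite ?setCT ?cards0 ?cardsT // -setI_eq0 set0I.
apply: (realizable_hom (f := f)) => // a b ab; apply: eX; rewrite ?fX ?inE //.
by rewrite (inj_eq fi); apply: contraTneq ab => ->; rewrite adj_irrefl.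
Qed.

(** Pairs are ordered, so each missing edge counts twice. *)
Definition missing_pairs e X : {set T * T} :=
  [set p | [&& p.1 \in X, p.2 \in X, p.1 != p.2 & ~~ e p.1 p.2]].

Definition missing e X := #|missing_pairs e X|.

Lemma missing_le e X : missing e X <= #|X| ^ 2.
Proof.
rewrite -mulnn -cardsX subset_leq_card //; apply/subsetP => p.
by rewrite !inE => /and4P[-> ->].
Qed.

Lemma missing_decr e e' X a b : symmetric e -> symmetric e' ->
    {in X &, forall x y, e x y -> e' x y} ->
    a \in X -> b \in X -> a != b -> ~~ e a b -> e' a b ->
  missing e' X + 2 <= missing e X.
Proof.
move=> es es' ee' aX bX ab neab e'ab.
rewrite /missing; set S := missing_pairs e X.
have baS : (b, a) \in S :\ (a, b).
  by rewrite !inE xpair_eqE /= [b == a]eq_sym (negPf ab) aX bX es neab.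
rewrite (cardsD1 (a, b) S) (cardsD1 (b, a) (S :\ (a, b))) baS !inE /= aX bX ab neab.
rewrite addnC leq_add2l subset_leq_card //.
apply/subsetP => -[x y]; rewrite !inE !xpair_eqE /= => /and4P[xX yX xy ne'xy].
rewrite xX yX xy (contra (ee' _ _ xX yX) ne'xy) !andbT -negb_or.
by apply: contra ne'xy => /orP[] /andP[/eqP-> /eqP->]; rewrite // es'.
Qed.

(** Induction on [missing e X]. A nonedge [a b] of [X] and a nonedge [x y] of [Y] are filled by one
    switch through the join; then [x] has lost [a] and [y] has lost [b], so both leave [Y]. Two
    vertices are spent and at least two ordered pairs gained, which preserves the last hypothesis.
    Once [X] is a clique, [C] goes to [Y] and the rest of [H] to [X]. *)
Lemma realizable_join C e X Y : independent C -> [disjoint X & Y] ->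
    symmetric e -> irreflexive e -> {in X & Y, forall x y, e x y} ->
    #|X| = #|~: C| -> #|H| + missing e X <= #|Y| -> realizable e.
Proof.
move=> indC; have [m] := ubnP (missing e X).
elim: m e Y => // m IH e Y lem dXY es ei eXY cX cY.
have [/pred0P X0|/pred0Pn[[a b]]] := boolP (pred0b
    [pred p : T * T | [&& p.1 \in X, p.2 \in X, p.1 != p.2 & ~~ e p.1 p.2]]).
  have eX : {in X &, forall x y, x != y -> e x y}.
    move=> x y xX yX xy; have := X0 (x, y).
    by rewrite /= xX yX xy /= => /negbFE.
  have [|||f [fi fC fX]] := @inj_split C X Y; rewrite ?cX //.
    by apply: leq_trans (leq_trans (leq_addr _ _) cY); apply: max_card.
  apply: (realizable_hom (f := f)) => // a b ab.
  have fab : f a != f b.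
    by rewrite (inj_eq fi); apply: contraTneq ab => ->; rewrite adj_irrefl.
  have [aC|aC] := boolP (a \in C); have [bC|bC] := boolP (b \in C).
  - by move/forall_inP/(_ _ aC)/forall_inP/(_ _ bC): indC; rewrite ab.
  - by rewrite es eXY ?fX ?fC.
  - by rewrite eXY ?fX ?fC.
  - by rewrite eX ?fX.
rewrite /= => /and4P[aX bX ab neab].
have [/pred0P Y0|/pred0Pn[[x y]]] := boolP (pred0b
    [pred p : T * T | [&& p.1 \in Y, p.2 \in Y, p.1 != p.2 & ~~ e p.1 p.2]]).
  apply: (@realizable_clique _ Y) => //; first exact: leq_trans (leq_addr _ _) cY.
  move=> x y xY yY xy; have := Y0 (x, y).
  by rewrite /= xY yY xy /= => /negbFE.
rewrite /= => /and4P[xY yY xy nexy].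
have [e' sw e'E] := switch2 es ei ab xy (eXY _ _ aX xY) (eXY _ _ bX yY) neab nexy.
have [es' ei' _] := sw; apply: (realizable_switch sw).
have XY z w : z \in X -> w \in Y -> z != w.
  by move=> zX wY; apply: contraTneq wY => <-; rewrite (disjointFr dXY).
have lm : missing e' X + 2 <= missing e X.
  apply: (@missing_decr _ _ _ a b) => //; last by rewrite e'E /same_pair !eqxx.
  move=> z w zX wX ezw; rewrite e'E ezw /same_pair.
  rewrite (negPf (XY _ _ zX xY)) (negPf (XY _ _ wX xY)).
  by rewrite (negPf (XY _ _ zX yY)) (negPf (XY _ _ wX yY)) /= ?andbF ?orbT.
apply: (IH e' (Y :\ x :\ y)) => //.
- by rewrite addn2 in lm; exact: leq_trans (ltnW lm) lem.
- by apply: disjointWr dXY; rewrite setDDl subsetDl.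
- move=> z w zX; rewrite !inE => /and3P[wy wx wY]; rewrite e'E eXY //.
  rewrite /same_pair (negPf wx) (negPf wy) !andbF /=.
  by rewrite (negPf (XY _ _ zX xY)) (negPf (XY _ _ zX yY)) /= ?andbF ?orbT.
have := cY; rewrite (cardsD1 x) (cardsD1 y (Y :\ x)) xY !inE eq_sym xy yY; lia.
Qed.

(** Switch partners are taken outside [I], so no edge inside [I] is lost. In the degree bound, one
    [#|H|] pays for removing [I], one for removing [X], and [#|H| ^ 2 + #|H|] remains for
    [realizable_join]. *)
Lemma realizable_large_degrees C e I : independent C ->
    symmetric e -> irreflexive e -> #|I| = #|H| ->
    {in I, forall v, #|H| ^ 2 + 3 * #|H| <= #|nbrs e v|} -> realizable e.
Proof.
move=> indC; have [m] := ubnP (missing e I).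
elim: m e => // m IH e lem es ei cI dI.
have [/pred0P I0|/pred0Pn[[a b]]] := boolP (pred0b
    [pred p : T * T | [&& p.1 \in I, p.2 \in I, p.1 != p.2 & ~~ e p.1 p.2]]).
  apply: (@realizable_clique _ I) => //; first by rewrite cI.
  move=> x y xI yI xy; have := I0 (x, y).
  by rewrite /= xI yI xy /= => /negbFE.
rewrite /= => /and4P[aI bI ab neab].
have dI' v : v \in I -> #|H| ^ 2 + 2 * #|H| <= #|nbrs e v :\: I|.
  move=> vI; have := dI v vI; rewrite -(cardsID I (nbrs e v)).
  by have := subset_leq_card (subsetIr (nbrs e v) I); rewrite cI; lia.
have [/pred0P N0|/pred0Pn[[x y]]] := boolP (pred0b
    [pred p : T * T | [&& p.1 \in nbrs e a :\: I, p.2 \in nbrs e b :\: I,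
       p.1 != p.2 & ~~ e p.1 p.2]]).
  have [|X sX cX] := @subset_with_card _ (nbrs e a :\: I) #|~: C|.
    apply: leq_trans (dI' a aI); apply: leq_trans (max_card _) _; lia.
  pose Y := (nbrs e b :\: I) :\: X.
  apply: (@realizable_join C e X Y) => //.
  - by rewrite disjoint_sym disjoints_subset; apply/subsetP => z; rewrite !inE => /andP[].
  - move=> x y xX; rewrite inE => /andP[yX yN]; have := N0 (x, y).
    rewrite /= (subsetP sX) // yN /=; case: eqP => [xy|_ /= /negbFE //].
    by rewrite -xy xX in yX.
  - have := missing_le e X; rewrite cX.
    have : #|~: C| <= #|H| by exact: max_card.
    have := dI' b bI; rewrite -(cardsID X (nbrs e b :\: I)) -/Y.
    by have := subset_leq_card (subsetIr (nbrs e b :\: I) X); rewrite cX; nia.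
rewrite /= !in_setD => /and4P[/andP[xI ax] /andP[yI by_] xy nexy].
rewrite !inE in ax by_.
have [e' sw e'E] := switch2 es ei ab xy ax by_ neab nexy.
have [es' ei' d'] := sw; apply: (realizable_switch sw).
have II z w : z \in I -> w \notin I -> z != w.
  by move=> zI; apply: contraNneq => <-.
apply: IH => //; last by move=> v vI; rewrite d' dI.
have : missing e' I + 2 <= missing e I.
  apply: (@missing_decr _ _ _ a b) => //; last by rewrite e'E /same_pair !eqxx.
  move=> z w zX wX ezw; rewrite e'E ezw /same_pair.
  rewrite (negPf (II _ _ zX xI)) (negPf (II _ _ wX xI)).
  by rewrite (negPf (II _ _ zX yI)) (negPf (II _ _ wX yI)) /= ?andbF ?orbT.
by rewrite addn2 => /ltnW lm; exact: leq_trans lm lem.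
Qed.

End Realizable.

(** * Building a copy edge by edge among vertices of bounded degree *)

Lemma card_bigcup_le (I T : finType) (A : {set I}) (F : I -> {set T}) m :
  {in A, forall i, #|F i| <= m} -> #|\bigcup_(i in A) F i| <= #|A| * m.
Proof.
move=> Fm; rewrite -sum_nat_const.
apply: (@leq_trans (\sum_(i in A) #|F i|)); last exact: leq_sum.
elim/big_rec2: _ => [|i n X _ IH]; first by rewrite cards0.
by rewrite (leq_trans (leq_card_setU _ _)) // leq_add2l.
Qed.

Section Sparse.

Variables (H : sgraph) (T : finType).
Hypothesis h0 : H.
Implicit Types (e : rel T) (X Y I L : {set T}) (C : {set H}) (f : H -> T).

(* In [need], a target edge from [a] into [L] is counted only while it is
   missing: the quantity then decreases together with the number of neighbours
   of [f a] outside [L]. *)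
Definition need e L f a :=
  [set b | adj a b & (f b \notin L) || ~~ e (f a) (f b)].

Definition outer e L : {set T} :=
  [set p | (p \notin L) && [exists q, (q \notin L) && e p q]].

(** Otherwise all neighbours of [f a] outside [L] would be images of elements of [need] other than
    [b], which are too few. *)
Lemma free_neighbor e L f a b : injective f ->
    #|need e L f a| <= #|~: L :&: nbrs e (f a)| ->
    adj a b -> ~~ e (f a) (f b) ->
  exists x, [/\ x \notin L, e (f a) x & forall c, adj a c -> f c != x].
Proof.
move=> fi na ab neab.
have [/pred0P N0|/pred0Pn[x]] := boolP (pred0b
  [pred x | [&& x \notin L, e (f a) x & [forall c, adj a c ==> (f c != x)]]]);
  last by case/and3P=> xL ex /forallP xP; exists x; split=> // c; apply/implyP.
suff : #|~: L :&: nbrs e (f a)| < #|need e L f a| by rewrite ltnNge na.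
have bn : b \in need e L f a by rewrite inE ab neab orbT.
rewrite (cardsD1 b) bn add1n ltnS -(card_imset _ fi) subset_leq_card //.
apply/subsetP => x; rewrite !inE => /andP[xL ex]; have := N0 x.
rewrite /= xL ex /= => /negbT; rewrite negb_forall => /existsP[c].
rewrite negb_imply negbK => /andP[ac /eqP xc].
apply/imsetP; exists c => //; rewrite !inE ac xc xL /= andbT.
by apply: contraNneq neab => <-; rewrite xc.
Qed.

(** Outside [L], at most [2 * M.+1] vertices equal or neighbour [x] or [y], and the balls around
    them cover at most [2 * M.+1 ^ 2] vertices. For [p] beyond this cover, neither [p] nor a
    neighbour [q] outside [L] is among them. *)
Lemma far_edge e L X x y M : symmetric e -> 
    (forall z, z \notin L -> #|nbrs e z| <= M) ->
    x \notin L -> y \notin L -> X \subset outer e L ->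
    2 * M.+1 ^ 2 < #|X| ->
  exists p q, [/\ p \in X, p \notin L, q \notin L & e p q] /\
    [/\ p \notin x |: nbrs e x, p \notin y |: nbrs e y,
        q \notin x |: nbrs e x & q \notin y |: nbrs e y].
Proof.
move=> es degM xL yL XO ltX.
pose ball z := z |: nbrs e z.
have ballM z : z \notin L -> #|ball z| <= M.+1.
  by move=> zL; rewrite /ball cardsU1 -[M.+1]add1n leq_add ?degM ?leq_b1.
pose bad := (ball x :|: ball y) :\: L.
have badM : #|bad| <= 2 * M.+1.
  apply: leq_trans (subset_leq_card (subsetDl _ _)) _.
  by rewrite (leq_trans (leq_card_setU _ _)) // mul2n -addnn leq_add ?ballM.
have /subsetPn[p pX pN] : ~~ (X \subset \bigcup_(z in bad) ball z).
  apply/negP => /subset_leq_card; rewrite leqNgt (leq_ltn_trans _ ltX) //.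
  rewrite (leq_trans (card_bigcup_le (m := M.+1) _)) //.
    by move=> z; rewrite inE => /andP[zL _]; apply: ballM.
  by rewrite -mulnn mulnA leq_mul2r badM orbT.
have := subsetP XO _ pX; rewrite inE => /andP[pL /existsP[q /andP[qL epq]]].
have pB : p \notin bad.
  by apply: contra pN => pb; apply/bigcupP; exists p => //; rewrite !inE eqxx.
have qB : q \notin bad.
  by apply: contra pN => pb; apply/bigcupP; exists q => //; rewrite !inE es epq orbT.
exists p, q; split; first by split.
move: pB qB; rewrite !in_setD pL qL /= !in_setU !negb_or /ball.
by case/andP=> -> -> /andP[-> ->].
Qed.

(** Induction on the number of edges of [H] missing from the image of [f]: [switch3] inserts one,
    removing only edges that are not images of edges of [H], and the bounds on [need] and [outer]
    survive. *)
Lemma realizable_sparse e L f M : symmetric e -> irreflexive e -> injective f ->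
    (forall z, z \notin L -> #|nbrs e z| <= M) ->
    (forall a, #|need e L f a| <= #|~: L :&: nbrs e (f a)|) ->
    2 * M.+1 ^ 2 < #|outer e L :\: f @: setT| -> realizable H e.
Proof.
move=> es ei fi.
pose miss e : {set H * H} := [set p | adj p.1 p.2 & ~~ e (f p.1) (f p.2)].
have [m] := ubnP #|miss e|; elim: m e es ei => // m IH e es ei lem degM needP outP.
have [miss0|/set0Pn[[a b]]] := eqVneq (miss e) set0.
  apply: (realizable_hom (f := f)) => // a b ab.
  by have /setP/(_ (a, b)) := miss0; rewrite !inE /= ab => /negbFE.
rewrite inE /= => /andP[ab neab].
have [x [xL ex xN]] := free_neighbor fi (needP a) ab neab.
have [||y [yL ey yN]] := free_neighbor (b := a) fi (needP b).
- by rewrite adj_sym.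
- by rewrite es.
(* Only [p] must avoid the image of [f]: this already keeps [p q] from being a target edge. That [q]
   differs from [f a] and [f b] follows from its nonadjacency to [x] and [y]. *)
have [p [q [[pX pL qL epq] [px py qx qy]]]] :=
  far_edge es degM xL yL (subsetDl _ _) outP.
have uv : f a != f b.
  by rewrite (inj_eq fi); apply: contraTneq ab => ->; rewrite adj_irrefl.
move: px py qx qy; rewrite !in_setU1 !negb_or !inE.
move=> /andP[px px'] /andP[py py'] /andP[qx qx'] /andP[qy qy'].
have pf c : f c != p.
  by apply: contraTneq pX => <-; rewrite inE imset_f ?inE.
have [||||||e' sw [out' e'E]] := switch3 (R := ~: L) es ei uv ex ey epq neab px' qy'.
- by rewrite !inE !negb_or px py !(eq_sym p) !pf.
- rewrite !inE !negb_or qx qy /=; apply/andP; split.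
    by apply: contraNneq qx' => ->; rewrite es.
  by apply: contraNneq qy' => ->; rewrite es.
- by rewrite inE.
- by rewrite inE.
- by rewrite inE.
- by rewrite inE.
have [es' ei' d'] := sw; apply: (realizable_switch sw).
have keep c d : adj c d -> e (f c) (f d) -> e' (f c) (f d).
  move=> cd ecd.
  have Nx : ~~ same_pair (f a) x (f c) (f d).
    rewrite /same_pair !(inj_eq fi) negb_or; apply/andP; split; apply/negP.
      by move=> /andP[/eqP ca /eqP dx]; have := xN d; rewrite -ca cd dx eqxx => /(_ isT).
    move=> /andP[/eqP cx /eqP da].
    by have := xN c; rewrite -da adj_sym cd cx eqxx => /(_ isT).
  have Ny : ~~ same_pair (f b) y (f c) (f d).
    rewrite /same_pair !(inj_eq fi) negb_or; apply/andP; split; apply/negP.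
      by move=> /andP[/eqP ca /eqP dx]; have := yN d; rewrite -ca cd dx eqxx => /(_ isT).
    move=> /andP[/eqP cx /eqP da].
    by have := yN c; rewrite -da adj_sym cd cx eqxx => /(_ isT).
  have Np : ~~ same_pair p q (f c) (f d).
    by rewrite /same_pair !(negPf (pf _)) /= andbF.
  by rewrite e'E ecd Nx Ny Np !orbT.
have e'ab : e' (f a) (f b) by rewrite e'E /same_pair !eqxx.
have need' c : need e' L f c \subset need e L f c.
  apply/subsetP => d; rewrite !inE => /andP[cd]; rewrite cd.
  by case/orP=> [->//|]; case: (boolP (e _ _)); rewrite ?orbT // => /(keep _ _ cd) ->.
apply: IH => //.
- rewrite -ltnS (leq_trans _ lem) // ltnS proper_card //; apply/properP; split.
    apply/subsetP => -[c d]; rewrite !inE /= => /andP[cd]; rewrite cd /=.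
    by apply: contra; apply: keep.
  by exists (a, b); rewrite !inE /= ab ?neab ?e'ab.
- by move=> z zL; rewrite d' degM.
- move=> c; have := out' (f c); have := needP c.
  rewrite !(inj_eq fi) !in_setC !negbK.
  (* An end of the new edge loses an outside neighbour only if the other end lies in [L]; then the
     inserted edge leaves [need], which compensates. *)
  have nD1 d : e (f c) (f d) = false -> e' (f c) (f d) -> f d \in L -> adj c d ->
      #|need e' L f c| < #|need e L f c|.
    move=> necd e'cd dL cd; rewrite proper_card //; apply/properP; split=> //.
    by exists d; rewrite inE cd ?necd ?e'cd ?orbT ?dL.
  have := subset_leq_card (need' c).
  have [ca|ca] := eqVneq c a; have [cb|cb] := eqVneq c b.
  + by rewrite -ca -cb adj_irrefl in ab.
  + have := nD1 b; rewrite ca (negPf neab) => /(_ erefl e'ab).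
    by case: (f b \in L) => [/(_ isT ab)|_]; rewrite ?addn0 /=; lia_nat.
  + have := nD1 a; rewrite cb es (negPf neab) es' adj_sym => /(_ erefl e'ab).
    by case: (f a \in L) => [/(_ isT ab)|_]; rewrite ?addn0 /=; lia_nat.
  + by rewrite /= !addn0; lia_nat.
(* The supply of far edges does not shrink: [x p] and [y q] are new edges outside [L], and any other
   vertex off the image keeps its edges. *)
- apply: leq_trans outP _; apply: subset_leq_card; apply/subsetP => z.
  rewrite !inE => /andP[zf /andP[zL /existsP[w /andP[wL ezw]]]]; rewrite zf zL /=.
  have zN c : z != f c by apply: contraNneq zf => ->; rewrite imset_f ?inE.
  have [zx|zx] := eqVneq z x.
    by apply/existsP; exists p; rewrite pL e'E /same_pair zx !eqxx ?orbT.
  have [zy|zy] := eqVneq z y.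
    by apply/existsP; exists q; rewrite qL e'E /same_pair zy !eqxx ?orbT.
  have [zp|zp] := eqVneq z p.
    by apply/existsP; exists x; rewrite xL e'E /same_pair zp !eqxx ?orbT.
  have [zq|zq] := eqVneq z q.
    by apply/existsP; exists y; rewrite yL e'E /same_pair zq !eqxx ?orbT.
  apply/existsP; exists w; rewrite wL e'E ezw /same_pair.
  by rewrite !(negPf (zN _)) (negPf zx) (negPf zy) (negPf zp) (negPf zq) /= ?orbT.
Qed.

(** Send [C] into [T0] and the rest into [B]. A vertex of [T0] needs at most [D] edges within [C]
    plus those it misses to [B]; a vertex of [L] has at least [#|H|] neighbours outside [L].
    Positivity puts [T0] inside [outer], and the image of [f] removes at most [#|H|] of it. *)
Lemma realizable_bounded_part C e L (B T0 : {set T}) D M : symmetric e -> irreflexive e ->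
    {in C, forall a, #|[set b in C | adj a b]| <= D} ->
    (forall z, z \notin L -> #|nbrs e z| <= M) ->
    (forall z, z \in L -> #|L| + #|H| <= #|nbrs e z|) ->
    B \subset L -> #|B| = #|~: C| -> T0 \subset ~: L ->
    {in T0, forall v, 0 < #|~: L :&: nbrs e v| /\
      D + #|B :\: nbrs e v| <= #|~: L :&: nbrs e v|} ->
    2 * M.+1 ^ 2 + #|H| < #|T0| ->
  realizable H e.
Proof.
move=> es ei degC degM degL BL cB T0L T0P cT0.
have CH : #|C| <= #|H| by exact: max_card.
have dBT : [disjoint B & T0].
  by rewrite disjoint_sym disjoints_subset (subset_trans T0L) // setCS.
have [||f [fi fC fB]] := inj_split (C := C) h0 dBT; first by rewrite cB.
  by apply: leq_trans (leq_trans CH (leq_addl _ _)) (ltnW cT0).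
have fL a : f a \in L -> a \notin C.
  by apply: contraL => /fC aT; have := subsetP T0L _ aT; rewrite inE.
have fNL a : f a \notin L -> a \in C.
  by apply: contraNT => /fB; apply: subsetP.
apply: (realizable_sparse (L := L) (f := f) (M := M)) => //.
  move=> a; have [aC|aC] := boolP (a \in C).
    have [_] := T0P _ (fC _ aC); apply: leq_trans.
    rewrite (leq_trans _ (leq_add (degC _ aC) (leqnn _))) //.
    rewrite -(cardsID C (need _ _ _ _)) leq_add //.
      apply: subset_leq_card; apply/subsetP => b; rewrite !inE.
      by case/andP=> /andP[-> _] ->.
    rewrite -(card_imset _ fi) subset_leq_card //; apply/subsetP => z /imsetP[b].
    rewrite !inE => /and3P[bC ab] + ->; rewrite (fB _ bC) andbT.
    by rewrite (subsetP BL _ (fB _ bC)).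
  have faL : f a \in L by rewrite (subsetP BL) ?fB.
  have := degL _ faL; rewrite -(cardsID L (nbrs e (f a))) => h.
  have : #|need e L f a| <= #|H| by exact: max_card.
  have := subset_leq_card (subsetIr (nbrs e (f a)) L).
  by rewrite (setIC (~: L)) -setDE; lia.
have : #|T0 :\: f @: setT| <= #|outer e L :\: f @: setT|.
  apply: subset_leq_card; apply: setSD; apply/subsetP => v vT.
  have vL := subsetP T0L _ vT; rewrite inE in vL.
  have [/card_gt0P[w]] := T0P _ vT; rewrite !inE vL => /andP[wL evw] _.
  by apply/existsP; exists w; rewrite wL.
apply: leq_trans; rewrite cardsD.
have := subset_leq_card (subsetIr T0 (f @: setT)).
by rewrite (card_imset _ fi) cardsT; lia.
Qed.

End Sparse.

(** * Extremal values of [nabla], [alpha] and [sigma_tilde] *)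

Section InducedDegrees.

Variable H : sgraph.
Implicit Types (C : {set H}) (i : nat).

Lemma degree_induced C (x : induced C) :
  degree x = #|[set b in C | adj (val x) b]|.
Proof.
rewrite /degree -(card_imset _ val_inj); apply: eq_card => b.
apply/imsetP/idP => [[y + ->]|]; rewrite !inE; first by rewrite (valP y).
by case/andP=> bC xb; exists (exist _ b bC) => //; rewrite inE.
Qed.

Lemma bigminn_le (I : eqType) (s : seq I) (P : pred I) (F : I -> nat) m (i : I) :
  i \in s -> P i -> \big[minn/m]_(j <- s | P j) F j <= F i.
Proof.
move=> + Pi; elim: s => // j s IH; rewrite inE big_cons => /orP[/eqP <-|/IH le].
  by rewrite Pi geq_minl.
by case: ifP => // _; apply: leq_trans le; rewrite geq_minr.
Qed.

Lemma nabla_le C : nabla H #|C| <= max_degree (induced C).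
Proof. by apply: bigminn_le; rewrite ?mem_index_enum. Qed.

Lemma nabla_attained i : i <= #|H| -> exists2 C : {set H}, #|C| = i &
  {in C, forall a, #|[set b in C | adj a b]| <= nabla H i}.
Proof.
move=> ik.
have degP C d : max_degree (induced C) <= d ->
    {in C, forall a, #|[set b in C | adj a b]| <= d}.
  move=> Cd a aC; apply: leq_trans Cd.
  by rewrite -(degree_induced (exist _ a aC : induced C)); apply: leq_bigmax.
(* The first alternative is the default of the iterated minimum; there any set of size [i] satisfies
   the bound. *)
have [] : nabla H i = #|H| \/ exists2 C : {set H}, #|C| = i &
    max_degree (induced C) = nabla H i.
  rewrite /nabla; elim/big_rec: _ => [|C m /eqP Ci IH]; first by left.
  by case: (leqP (max_degree (induced C)) m) => // _; right; exists C.
  have [|C _ Ci ->] := @subset_with_card H setT i; first by rewrite cardsT.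
  by exists C => // a _; apply: max_card.
by case=> C Ci Cd; exists C => //; apply: degP; rewrite Cd.
Qed.

Lemma alpha_attained : exists2 C : {set H}, independent C & #|C| = alpha H.
Proof.
have [|C iC aE] := @eq_bigmax_cond _ (@independent H) (fun A => #|A|).
  by apply/card_gt0P; exists set0; apply/forall_inP => x; rewrite inE.
by exists C => //; apply: esym.
Qed.

Lemma alpha_lt : (exists x y : H, adj x y) -> alpha H < #|H|.
Proof.
case=> x [y xy]; have [C iC <-] := alpha_attained.
rewrite -cardsT proper_card // properEneq subsetT andbT.
apply: contraTneq iC => ->; apply/negP => /forall_inP/(_ x (in_setT x)).
by move=> /forall_inP/(_ y (in_setT y)); rewrite xy.
Qed.

Lemma nabla_gt0 i : alpha H < i <= #|H| -> 0 < nabla H i.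
Proof.
case/andP=> ai /nabla_attained[C Ci Cd]; rewrite lt0n; apply: contraTneq ai => n0.
rewrite -leqNgt -Ci; apply: (@leq_bigmax_cond _ (@independent H) (fun A => #|A|)).
apply/forall_inP => x xC; apply/forall_inP => y yC; apply/negP => xy.
have := Cd x xC; rewrite n0 leqNgt => /negP; apply.
by apply/card_gt0P; exists y; rewrite inE yC.
Qed.

Lemma sigma_tilde_ge i : alpha H < i <= #|H| ->
  2 * (#|H| - i) + nabla H i - 1 <= sigma_tilde H.
Proof.
move=> iP; rewrite /sigma_tilde; apply: (@leq_bigmax_seq _ _ _ _ i) => //.
by rewrite mem_index_iota ltnS.
Qed.

Lemma sigma_tilde_attained : alpha H < #|H| -> exists2 i, alpha H < i <= #|H| &
  sigma_tilde H = 2 * (#|H| - i) + nabla H i - 1.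
Proof.
move=> ak; have [] : sigma_tilde H = 0 \/ exists2 i, alpha H < i <= #|H| &
    sigma_tilde H = 2 * (#|H| - i) + nabla H i - 1.
  rewrite /sigma_tilde big_nat; elim/big_rec: _ => [|i m iP IH]; first by left.
  by case: (leqP m (sigma_tilde_at H i)) => // _; right; exists i.
  (* If the maximum is its default 0, all its terms vanish and any admissible index attains it. *)
  move=> st0; exists (alpha H).+1; first by rewrite leqnn.
  have : alpha H < (alpha H).+1 <= #|H| by rewrite leqnn.
  by move/sigma_tilde_ge; rewrite st0 leqn0 => /eqP ->.
by [].
Qed.

End InducedDegrees.

(** * Counting edges at the vertices of large degree *)

Section DegreeSum.

Variables (T : finType) (e : rel T) (L : {set T}).
Hypotheses (es : symmetric e).

(** Edges leaving [L] are charged twice to their outer end; inside [L] there are at most [#|L| ^ 2]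
    ordered pairs. *)
Lemma sum_nbrs_le :
  \sum_x #|nbrs e x| <=
  #|L| ^ 2 + \sum_(x | x \notin L) (#|nbrs e x| + #|L :&: nbrs e x|).
Proof.
rewrite (bigID (mem L)) /= big_split /= addnCA [X in _ <= X]addnC addnC.
rewrite [X in _ <= X]addnC leq_add2l.
have -> : \sum_(x | x \notin L) #|L :&: nbrs e x| = \sum_(x in L) #|nbrs e x :\: L|.
  under eq_bigr do rewrite card_nbrs; rewrite exchange_big /=.
  apply: eq_bigr => x _; rewrite setDE setIC card_nbrs.
  rewrite [RHS](eq_bigl (fun y => y \notin L)) => [|y]; last by rewrite inE.
  by apply: eq_bigr => y _; rewrite es.
rewrite -mulnn -sum_nat_const -big_split /= leq_sum // => x _.
by rewrite -(cardsID L (nbrs e x)) leq_add2r subset_leq_card ?subsetIr.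
Qed.

(** Used contrapositively: a degree sum far above [c * #|T|] forces many vertices of degree at least
    [d] outside [L], since the others contribute at most [c] each. *)
Lemma many_nbrs (M d c : nat) : (forall x, x \notin L -> #|nbrs e x| <= M) ->
    (forall x, x \notin L -> #|nbrs e x| < d -> #|nbrs e x| + #|L :&: nbrs e x| <= c) ->
  \sum_x #|nbrs e x| <=
    #|L| ^ 2 + c * #|T| + 2 * M * #|[set x | (x \notin L) && (d <= #|nbrs e x|)]|.
Proof.
move=> degM small; apply: leq_trans sum_nbrs_le _; rewrite -addnA leq_add2l.
set S := [set x | _].
rewrite (bigID (mem S)) /= addnC; apply: leq_add.
  apply: (@leq_trans (\sum_(x : T | (x \notin L) && (x \notin S)) c)).
    apply: leq_sum => x /andP[xL]; rewrite inE xL /= -ltnNge; exact: small.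
  by rewrite sum_nat_const mulnC leq_mul2l max_card orbT.
apply: (@leq_trans (\sum_(x in S) (2 * M))); last by rewrite sum_nat_const mulnC.
rewrite big_mkcond [X in _ <= X]big_mkcond leq_sum // => x _.
case: ifP => [/andP[xL ->]|//].
rewrite mul2n -addnn leq_add ?degM // (leq_trans _ (degM x xL)) //.
by rewrite subset_leq_card ?subsetIr.
Qed.

(** Pigeonhole over the subsets of [L]. *)
Lemma common_trace (S : {set T}) N : 2 ^ #|L| * N < #|S| ->
  exists A : {set T}, N < #|[set v in S | L :&: nbrs e v == A]|.
Proof.
move=> SN; apply/existsP; rewrite -[[exists _, _]]negbK negb_exists.
apply: contraL SN => /forallP all; rewrite -leqNgt -card_powerset.
pose F A := [set v in S | L :&: nbrs e v == A].
apply: leq_trans (card_bigcup_le (F := F) (m := N) _); last first.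
  by move=> A _; rewrite leqNgt; apply: all.
apply: subset_leq_card; apply/subsetP => v vS; apply/bigcupP.
by exists (L :&: nbrs e v); rewrite ?powersetE ?subsetIl // inE vS eqxx.
Qed.

End DegreeSum.

(** * Upper bound: a large degree sum forces a copy of [H] *)

(** The degree required by [realizable_large_degrees]. *)
Definition degree_bound k := k ^ 2 + 3 * k.
(** The size of [T0] required by [realizable_bounded_part]; it also suffices for
    [realizable_join]. *)
Definition class_size k := 2 * (degree_bound k).+1 ^ 2 + k.
(** Pays for the pairs inside [L] and for up to [2 ^ k * class_size k] exceptional vertices; the
    final 1 makes the comparison strict. *)
Definition excess k :=
  k ^ 2 + 2 * degree_bound k * (2 ^ k * class_size k + 1) + 1.

Lemma realizable_of_sum (H : sgraph) (T : finType) (e : rel T) :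
    (exists x y : H, adj x y) -> symmetric e -> irreflexive e ->
    sigma_tilde H * #|T| + excess #|H| <= \sum_x #|nbrs e x| ->
  realizable H e.
Proof.
move=> edge es ei big_sum; set k := #|H| in big_sum.
have [h0 _] : exists h0 : H, True by case: edge => x; exists x.
have ak := alpha_lt edge.
have [C0 iC0 cC0] := alpha_attained H.
have cC0' : #|~: C0| = k - alpha H by rewrite /k -(cardsC C0) cC0 addKn.
pose M := degree_bound k; pose L := [set x | M <= #|nbrs e x|].
have degM x : x \notin L -> #|nbrs e x| <= M by rewrite inE -ltnNge => /ltnW.
have [kL|Lk] := leqP k #|L|.
  have [I IL cI] := subset_with_card kL.
  apply: (realizable_large_degrees h0 iC0 es ei cI) => v vI.
  by have := subsetP IL _ vI; rewrite inE.
have degL z : z \in L -> #|L| + #|H| <= #|nbrs e z|.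
  by rewrite inE; apply: leq_trans; rewrite /M /degree_bound; lia.
have many d c : c <= sigma_tilde H ->
    (forall x, x \notin L -> #|nbrs e x| < d -> #|nbrs e x| + #|L :&: nbrs e x| <= c) ->
    2 ^ k * class_size k < #|[set x | (x \notin L) && (d <= #|nbrs e x|)]|.
  move=> cs small; have := leq_trans big_sum (many_nbrs es degM small).
  rewrite ltnNge; apply: contraL => few; rewrite -ltnNge /excess -/M.
  have : #|L| ^ 2 <= k ^ 2 by rewrite leq_exp2r // ltnW.
  have : c * #|T| <= sigma_tilde H * #|T| by rewrite leq_mul2r cs orbT.
  have : 2 * M * #|[set x | (x \notin L) && (d <= #|nbrs e x|)]|
      <= 2 * M * (2 ^ k * class_size k + 1).
    by rewrite leq_mul2l (leq_trans few) ?orbT // leq_addr.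
  by lia_nat.
have [jr|rj] := ltnP #|L| (k - alpha H).
  pose i := k - #|L|.
  have iP : alpha H < i <= #|H| by rewrite /i -/k; lia.
  have [C Ci Cd] := nabla_attained (proj2 (andP iP)).
  have n0 := nabla_gt0 iP; have st := sigma_tilde_ge iP.
  have ki : #|H| - i = #|L| by rewrite /i -/k; lia.
  rewrite ki in st.
  pose T0 := [set x | (x \notin L) && (#|L| + nabla H i <= #|nbrs e x|)].
  apply: (@realizable_bounded_part H T h0 C e L L T0 (nabla H i) M) => //.
  - by rewrite -ki -Ci -(cardsC C) addKn.
  - by apply/subsetP => x; rewrite !inE => /andP[].
  - move=> v; rewrite inE => /andP[vL]; rewrite -(cardsID L (nbrs e v)).
    rewrite (setIC (~: L)) -setDE -[X in X + _](cardsID (nbrs e v) L) (setIC L); lia.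
  (* A vertex of degree at most [#|L| + nabla H i - 1] is charged at most
     [2 * #|L| + nabla H i - 1], which is the value of [sigma_tilde_at] at [i]. *)
  - apply: leq_trans (many _ _ st _).
      by rewrite ltnS -[X in X <= _]mul1n leq_mul2r expn_gt0 orbT.
    move=> x xL xd; have := subset_leq_card (subsetIl L (nbrs e x)); lia.
(* The index [(alpha H).+1], where [nabla] is positive; the left side bounds the charge of a vertex
   of degree below [k - alpha H]. *)
have st : 2 * (k - (alpha H).+1) <= sigma_tilde H.
  have iP : alpha H < (alpha H).+1 <= #|H| by rewrite leqnn.
  by have := sigma_tilde_ge iP; have := nabla_gt0 iP; rewrite -/k; lia.
pose S := [set x | (x \notin L) && (k - alpha H <= #|nbrs e x|)].
have bigS : 2 ^ k * class_size k < #|S|.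
  apply: many st _ => x xL xd.
  by have := subset_leq_card (subsetIr L (nbrs e x)); lia.
have [|A] := @common_trace _ e L S (class_size k).
  by apply: leq_ltn_trans bigS; rewrite leq_mul2r leq_exp2l // ltnW ?orbT.
set W := [set v in S | _] => cW.
have WP v : v \in W -> [/\ v \notin L, k - alpha H <= #|nbrs e v| & L :&: nbrs e v = A].
  by rewrite !inE => /andP[/andP[-> ->] /eqP ->].
have [w wW] : exists w, w \in W by apply/card_gt0P; exact: leq_ltn_trans cW.
have AL : A \subset L by have [_ _ <-] := WP w wW; rewrite subsetIl.
have [rA|Ar] := leqP (k - alpha H) #|A|.
  have [X XA cX] := subset_with_card rA.
  apply: (@realizable_join H T h0 C0 e X W) => //.
  - rewrite disjoint_sym disjoints_subset; apply/subsetP => v /WP[vL _ _].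
    by rewrite inE; apply: contra vL => /(subsetP XA)/(subsetP AL).
  - move=> x v xX /WP[_ _ vA]; have := subsetP XA _ xX.
    by rewrite -vA !inE es => /andP[].
  - by rewrite cX cC0'.
  - apply: leq_trans (ltnW cW); have := missing_le e X.
    rewrite cX /class_size /degree_bound -/k; nia.
(* With [C0] independent, a vertex of [W] needs only its [k - alpha H - #|A|] missing edges to [B],
   and it has at least that many neighbours outside [L]. *)
have [B [AB BL cB]] : exists B : {set T},
    [/\ A \subset B, B \subset L & #|B| = k - alpha H].
  have [|X XL cX] := @subset_with_card _ (L :\: A) (k - alpha H - #|A|).
    by rewrite cardsD (setIidPr AL) leq_sub2r.
  exists (A :|: X); split; first exact: subsetUl.
    by rewrite subUset AL (subset_trans XL) ?subsetDl.
  rewrite cardsU cX disjoint_setI0 ?cards0; first by lia.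
  by rewrite disjoint_sym disjoints_subset (subset_trans XL) // setDE subsetIr.
apply: (@realizable_bounded_part H T h0 C0 e L B W 0 M) => //.
- move=> a aC; rewrite leqn0 cards_eq0; apply/eqP/setP => b; rewrite !inE.
  apply/negP => /andP[bC].
  by move/forall_inP/(_ _ aC)/forall_inP/(_ _ bC): iC0 => /negPf ->.
- by rewrite cB cC0'.
- by apply/subsetP => v /WP[vL _ _]; rewrite inE.
- move=> v /WP[vL dv vA]; have := dv; rewrite -(cardsID L (nbrs e v)) (setIC _ L) vA.
  rewrite (setIC (~: L)) -setDE.
  have -> : B :\: nbrs e v = B :\: A.
    apply/setP => x; rewrite -vA !(in_setD, in_setI).
    case xB: (x \in B); rewrite ?andbF //.
    by rewrite (subsetP BL _ xB).
  by rewrite (cardsD B) (setIidPr AB) cB; lia.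
Qed.

(** * Lower bound: the join of a clique with disjoint cliques *)

Section Extremal.

Variables l q d s : nat.

Local Notation joined_cliques := ('I_l + ('I_q * 'I_d + 'I_s))%type.

(** The pair [(c, i)] is the vertex [i] of the clique [c]. The [s] last vertices, adjacent only to
    the first [l], pad the order when [d] does not divide it. *)
Definition joined_cliques_adj (x y : joined_cliques) : bool :=
  match x, y with
  | inr (inl (c, i)), inr (inl (c', i')) => (c == c') && (i != i')
  | inr _, inr _ => false
  | _, _ => x != y
  end.

Lemma joined_cliques_sym : symmetric joined_cliques_adj.
Proof.
move=> x y; case: x => [i|[[c i]|i]]; case: y => [j|[[c' j]|j]] //=.
  by rewrite eq_sym.
by rewrite (eq_sym c) (eq_sym i).
Qed.

Lemma joined_cliques_irr : irreflexive joined_cliques_adj.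
Proof. by move=> x; case: x => [i|[[c i]|i]]; rewrite /= ?eqxx ?andbF. Qed.

Definition joined_cliques_graph := SGraph joined_cliques_sym joined_cliques_irr.

Lemma joined_cliques_degree (x : joined_cliques_graph) : degree x =
  match x with
  | inl _ => (l + (q * d + s)).-1
  | inr (inl _) => l + d.-1
  | inr (inr _) => l
  end.
Proof.
have dE : degree x = \sum_(y : joined_cliques) joined_cliques_adj x y.
  rewrite /degree -sum1_card big_mkcond; apply: eq_bigr => y _. 
  by rewrite inE /=; case: joined_cliques_adj.
have sum_ne n (i : 'I_n) : \sum_(j < n) (i != j) = n.-1.
  have := cardsC1 i; rewrite card_ord => <-; rewrite -sum1_card [RHS]big_mkcond.
  by apply: eq_bigr => j _; rewrite !inE eq_sym; case: eqP.
have sum1n n : \sum_(j < n) 1 = n by rewrite sum1_card card_ord.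
case: x dE => [i|[[c i]|i]] ->.
- rewrite /joined_cliques_adj.
  have := cardsC1 (inl i : joined_cliques); rewrite !card_sum card_prod !card_ord => <-.
  rewrite -sum1_card [RHS]big_mkcond; apply: eq_bigr => j _.
  by rewrite !inE eq_sym; case: eqP.
- rewrite !big_sumType /= sum1n big1_eq addn0; congr (_ + _).
  transitivity (\sum_(c' < q) \sum_(j < d) ((c == c') && (i != j))).
    by rewrite pair_bigA; apply: eq_bigr => -[c' j].
  rewrite (bigD1 c) //= eqxx sum_ne big1 ?addn0 // => c' cc'.
  by rewrite eq_sym (negPf cc') big1.
- by rewrite !big_sumType /= sum1n !big1_eq !addn0.
Qed.

End Extremal.

Lemma universal_adj (G : sgraph) (u y : G) : degree u = #|G|.-1 -> y != u -> adj u y.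
Proof.
move=> du yu; have sub : [set y | adj u y] \subset [set~ u].
  by apply/subsetP => z; rewrite !inE; apply: contraTneq => ->; rewrite adj_irrefl.
have : [set y | adj u y] == [set~ u] by rewrite eqEcard sub cardsC1 -du leqnn.
by move/eqP/setP/(_ y); rewrite !inE yu.
Qed.

(** A copy of [H] has [i] vertices outside [U]. One of them has [nabla H i] neighbours among these,
    besides all of [U], so its degree is too large. *)
Lemma not_contains (G H : sgraph) (U : {set G}) i :
    0 < i -> #|U| + i <= #|H| ->
    {in U, forall u, degree u = #|G|.-1} ->
    {in ~: U, forall u, degree u < #|U| + nabla H i} -> ~ contains G H.
Proof.
move=> i0 HU degU degN [f fi fP].
have [|C CU Ci] := @subset_with_card _ [set a | f a \notin U] i.
  have : #|[set a | f a \in U]| <= #|U|.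
    rewrite -(card_imset _ fi) subset_leq_card //.
    by apply/subsetP => x /imsetP[a + ->]; rewrite inE.
  have cH : #|[set a | f a \in U]| + #|[set a | f a \notin U]| = #|H|.
    rewrite -[RHS](cardsC [set a | f a \in U]); congr (_ + _).
    by apply: eq_card => a; rewrite !inE.
  by move: HU; rewrite -cH; lia.
have [|a aE] := eq_bigmax (fun x : induced C => degree x).
  by rewrite card_sig cardE -cardE Ci.
have da : nabla H i <= #|[set b in C | adj (val a) b]|.
  by rewrite -degree_induced -aE -Ci nabla_le.
have faU : f (val a) \in ~: U.
  by have := subsetP CU _ (valP a); rewrite !inE.
have := degN _ faU; rewrite ltnNge => /negP; apply.
pose X := f @: [set b in C | adj (val a) b].
have UX : U :&: X = set0.
  apply/setP => x; rewrite !inE; apply/negP => /andP[xU /imsetP[b + xb]].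
  by rewrite inE => /andP[/(subsetP CU)]; rewrite inE -xb xU.
apply: (@leq_trans #|U :|: X|).
  by rewrite cardsU UX cards0 subn0 leq_add2l (card_imset _ fi).
apply: subset_leq_card; apply/subsetP => x; rewrite !inE => /orP[xU|/imsetP[b + ->]].
  rewrite adj_sym universal_adj ?degU //; apply: contraTneq xU => <-.
  by rewrite inE in faU.
by rewrite inE => /andP[_ /fP].
Qed.

Lemma count_degree (G : sgraph) pi (p : pred nat) : realization pi G ->
  #|[set x : G | p (degree x)]| = count p pi.
Proof.
by move=> /permP <-; rewrite -sum1_count big_map big_enum_cond /= -sum1dep_card.
Qed.

Lemma sum_degree_perm (G : sgraph) pi : realization pi G ->
  sumn pi = \sum_(x : G) degree x.
Proof. by move=> /perm_sumn <-; rewrite sumnE big_map big_enum. Qed.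

(** Here [t] stands for [q * d]. The loss is [l] from the universal degrees, [s * (d - 1)] from the
    padding and [l * (l + d - 1)] from the [l] universal vertices. *)
Lemma joined_cliques_sum l d s t n : s < d -> t + s + l = n ->
  (2 * l + d - 1) * n <=
    l * n.-1 + (t * (l + d.-1) + s * l) + (l + d) ^ 2 * 2.
Proof.
case: d => // d sd <-; rewrite addnS subn1 /= -mulnn.
have ln : l * (t + s + l) <= l * (t + s + l).-1 + l.
  by case: (t + s + l) => [|m] /=; rewrite ?leq_addr // mulnS addnC.
have sdd : s * d <= d * d by rewrite leq_mul2r -ltnS sd orbT.
by move: (l * (t + s + l).-1) ln => m ln; lia.
Qed.

Lemma sigma_lower (H : sgraph) i n : alpha H < i <= #|H| ->
    #|H| - i + nabla H i < n ->
  (2 * (#|H| - i) + nabla H i - 1) * n <=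
    sigma H n + ((#|H| - i) + nabla H i) ^ 2 * 2.
Proof.
move=> iP; have := nabla_gt0 iP; set l := #|H| - i; set d := nabla H i => d0 ln.
pose q := (n - l) %/ d; pose s := (n - l) %% d.
have qs : l + (q * d + s) = n by rewrite -divn_eq subnKC //; lia.
have sd : s < d by rewrite ltn_mod.
pose K := joined_cliques_graph l q d s.
have cK : #|K| = n by rewrite !card_sum card_prod !card_ord.
pose pi := [seq degree x | x : K].
have piK : realization pi K by exact: perm_refl.
have sum_pi : (2 * l + d - 1) * n <= sumn pi + (l + d) ^ 2 * 2.
  rewrite (sum_degree_perm piK) (eq_bigr _ (fun x _ => joined_cliques_degree x)).
  rewrite !big_sumType /=.
  rewrite !sum_nat_const card_prod !card_ord qs.
  have : q * d + s + l = n by lia.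
  by move: (q * d) => t; apply: joined_cliques_sum.
apply: leq_trans sum_pi _; rewrite leq_add2r /sigma.
case: ex_minnP => m /asboolP[_ adm] _; rewrite leqNgt; apply/negP => /ltnW m_pi.
have szpi : size pi = n by rewrite size_map -cardE.
have [|G piG] := adm pi szpi _ m_pi; first by exists K.
have cG : #|G| = n by rewrite -szpi -(perm_size piG) size_map -cardE.
(* The degree sequence alone identifies the universal vertices, in any realization: [n - 1] is at
   least [l + d], and all other degrees are smaller. *)
pose U := [set u : G | l + d <= degree u].
have cU : #|U| = l.
  rewrite (count_degree (leq (l + d)) piG) -(count_degree _ piK).
  have inl_inj : injective (inl : 'I_l -> K) by move=> x y [].
  rewrite -[RHS]card_ord -[RHS](card_imset _ inl_inj); apply: eq_card => x.
  rewrite inE joined_cliques_degree; case: x => [j|[[c j]|j]].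
  - by rewrite imset_f // qs; lia.
  - by apply/idP/imsetP => [|[y _ //]]; lia.
  - by apply/idP/imsetP => [|[y _ //]]; lia.
apply: (@not_contains G H U i) => //; first by lia.
- by rewrite cU /l; lia.
- move=> u; rewrite inE => du; have : degree u \in pi.
    by rewrite -(perm_mem piG) map_f // mem_enum.
  case/mapP=> x _ ux; move: du; rewrite ux joined_cliques_degree.
  by case: x ux => [j|[[c j]|j]] _ h; rewrite ?cG ?qs //; lia.
- by move=> u; rewrite !inE -ltnNge cU.
Qed.

(** * Linear bounds on [sigma] and the asymptotic statement *)

Lemma sigma_upper (H : sgraph) n : (exists x y : H, adj x y) ->
  sigma H n <= sigma_tilde H * n + excess #|H| + 1.
Proof.
move=> edge; pose N := sigma_tilde H * n + excess #|H|.
(* Admissible values are even, so [N] is rounded up, at a cost of at most 1. *)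
rewrite -/N /sigma; case: ex_minnP => m _ /(_ (N + odd N)) le.
apply: leq_trans (le _) _; last by rewrite leq_add2l; case: odd.
apply/asboolP; split; first by rewrite oddD oddb addbb.
move=> pi szpi [G piG] big.
have cG : #|G| = n by rewrite -szpi -(perm_size piG) size_map -cardE.
have [] := @realizable_of_sum H G (@adj G) edge (@adj_sym G) (@adj_irrefl G).
  by rewrite cG -/N (leq_trans (leq_addr _ _) (leq_trans big _)) // (sum_degree_perm piG).
move=> e [es ei ed] [f fi fP]; exists (SGraph es ei); last by exists f.
have dE : [seq degree x | x : SGraph es ei] = [seq degree x | x : G].
  by apply: eq_map => x; apply: ed.
by rewrite /realization dE.
Qed.

Lemma sigma_asymptotics (H : sgraph) : (exists x y : H, adj x y) ->
  exists C n0, forall n, n0 <= n ->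
    sigma H n <= sigma_tilde H * n + C /\ sigma_tilde H * n <= sigma H n + C.
Proof.
move=> edge; have [i iP stE] := sigma_tilde_attained (alpha_lt edge).
pose C1 := (#|H| - i + nabla H i) ^ 2 * 2; pose C2 := excess #|H| + 1.
exists (C1 + C2), (#|H| - i + nabla H i).+1 => n nP; split.
  by apply: leq_trans (sigma_upper n edge) _; rewrite -addnA leq_add2l leq_addl.
rewrite stE; apply: leq_trans (sigma_lower iP nP) _.
by rewrite leq_add2l leq_addr.
Qed.

From mathcomp Require Import all_order all_algebra.
From mathcomp Require Import all_classical all_reals all_analysis.
Import Order.TTheory GRing.Theory Num.Theory.
Import numFieldNormedType.Exports.
Local Open Scope classical_set_scope.
Local Open Scope ring_scope.
Unset Implicit Arguments.

Theorem theorem2 (R : realType) (H : sgraph)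
    (H_edge : exists x y : H, adj x y) :
  (fun n : nat => (sigma H n)%:R : R) =
  (fun n : nat => (sigma_tilde H)%:R * n%:R : R) +o_\oo (fun n : nat => n%:R : R).
Proof.
have [C [n0 bounds]] := sigma_asymptotics H_edge.
apply/eqaddoP => eps eps0; near=> n.
have [upper lower] : (sigma H n <= sigma_tilde H * n + C /\
    sigma_tilde H * n <= sigma H n + C)%N.
  by apply: bounds; near: n; exact: nbhs_infty_ge.
(* The error is at most the constant [C], hence at most [eps * n] once [n] exceeds [C / eps]. *)
rewrite [`|n%:R|]ger0_norm // (@le_trans _ _ C%:R) //.
  rewrite !fctE -natrM ler_norml lerBlDl -natrD ler_nat upper andbT.
  by rewrite lerBrDr addrC lerBlDr -natrD ler_nat.
rewrite -ler_pdivrMl //; near: n; exact: nbhs_infty_ger.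
Unshelve. all: by end_near.
Qed.
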